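(* Let $n\ge1$, let $C\subset\mathbb{R}^n$ be a convex body and suppose $\iota\colon\partial C\to X$ is an isometric embedding into an ($n$-dimensional) integral current space $X$ such that $\iota_\#[\![\partial C]\!]=[\![\partial X]\!]$. Then $$\mathbf{M}([\![X]\!])\ \ge\ \mathrm{Vol}^n(C).$$
   Context: Conventions. A convex body is a compact convex set with non-empty interior. Subsets of metric spaces carry the subspace metric; $\mathbb{R}^n$ is Euclidean. An isometric embedding is a distance-preserving map. $\mathrm{Vol}^n=\mathcal{H}^n$ is Hausdorff measure normalized so that $\mathcal{H}^n_{\mathbb{R}^n}$ is Lebesgue measure $\mathcal{L}^n$; $\omega_n=\mathcal{L}^n(B^n)$ with $B^n$ the closed Euclidean unit ball. $\overline{X}$ denotes the metric completion of $X$. $\mathbb{R}^0$ is a point. Metric currents (Ambrosio--Kirchheim). Let $Z$ be a complete metric space and $n\ge 0$. $\mathcal{D}^n(Z)$ is the set of tuples $(h,\pi_1,\dots,\pi_n)$ of real-valued Lipschitz functions on $Z$ with $h$ bounded. An $n$-current on $Z$ is an $(n+1)$-multilinear map $T\colon\mathcal{D}^n(Z)\to\mathbb{R}$ such that: (i) $T(h,\pi^{(j)}_1,\dots,\pi^{(j)}_n)\to T(h,\pi_1,\dots,\pi_n)$ whenever $\pi_i^{(j)}\to\pi_i$ pointwise as $j\to\infty$ with uniformly bounded Lipschitz constants; (ii) $T(h,\pi_1,\dots,\pi_n)=0$ if some $\pi_i$ is constant on an open neighborhood of $\{h\ne0\}$; (iii) there is a finite Borel measure $\mu$ on $Z$ with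 $|T(h,\pi_1,\dots,\pi_n)|\le\prod_i\mathrm{Lip}(\pi_i)\int_Z|h|\,d\mu$. The minimal such $\mu$ is the mass measure $\|T\|$; $\mathbf{M}(T)=\|T\|(Z)$ and $\operatorname{spt}T=\operatorname{spt}\|T\|$. Throughout one may assume (consistently with ZFC; automatic for separable spaces) that finite Borel measures on complete metric spaces are concentrated on their supports. For a Lipschitz map $f\colon Z\to Z'$ of complete spaces, $f_\#T(h,\pi_1,\dots,\pi_n)=T(h\circ f,\pi_1\circ f,\dots,\pi_n\circ f)$; for Lipschitz maps between non-complete spaces, $f_\#$ means the push-forward under the unique Lipschitz extension to the completions. For $n\ge1$, $\partial T(h,\pi_1,\dots,\pi_{n-1})=T(1,h,\pi_1,\dots,\pi_{n-1})$. Integral currents and integral current spaces. For $\theta\in L^1(\mathbb{R}^n)$ put $[\![\theta]\!](h,\pi_1,\dots,\pi_n)=\int_{\mathbb{R}^n}\theta h\det[\partial_i\pi_j]\,d\mathcal{L}^n$. $T$ is integer-rectifiable if there are compact $K_i\subset\mathbb{R}^n$, $\Theta_i\in L^1(\mathbb{R}^n;\mathbb{Z})$ with $\operatorname{spt}\Theta_i\subset K_i$ and bi-Lipschitz embeddings $\varphi_i\colon K_i\to Z$ ($i\in\mathbb{N}$) with $T=\sum_i\varphi_{i\#}[\![\Theta_i]\!]$ and $\mathbf{M}(T)=\sum_i\mathbf{M}(\varphi_{i\#}[\![\Theta_i]\!])$. $T$ is an integral current, $T\in\mathbf{I}_n(Z)$, if it is integer-rectifiable and (for $n\ge1$) $\partial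 T$ is an $(n-1)$-current; then $\partial T\in\mathbf{I}_{n-1}(Z)$. The characteristic set is $\operatorname{set}T=\{z\in Z:\liminf_{r\downarrow0}\|T\|(B(z,r))/(\omega_nr^n)>0\}$. An $n$-dimensional integral current space is a pair $(X,T)$ with $X$ a metric space and $T\in\mathbf{I}_n(\overline{X})$ with $\operatorname{set}T=X$; one writes $X$ for the pair and $[\![X]\!]=T$. Its boundary is the integral current space $\partial X=(\operatorname{set}\partial T,\partial T)$, so $[\![\partial X]\!]=\partial[\![X]\!]$. For a convex body $C\subset\mathbb{R}^n$, $[\![C]\!]=[\![\mathbf{1}_C]\!]$ and $[\![\partial C]\!]=\partial[\![C]\!]$ (viewed as a current on $\partial C$). *)

(* Defs.v *)
From HB Require Import structures.
From mathcomp Require Import all_boot all_order all_algebra.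
From mathcomp Require Import all_classical all_reals all_analysis.
From mathcomp Require Import measurable_realfun.
From mathcomp Require Import ring.

Set Implicit Arguments.
Unset Strict Implicit.
Unset Printing Implicit Defensive.

Import Order.TTheory GRing.Theory Num.Theory.
Import numFieldNormedType.Exports.

Local Open Scope classical_set_scope.
Local Open Scope ring_scope.

Definition fcons (A : Type) (n : nat) (a : A) (f : 'I_n -> A) : 'I_n.+1 -> A :=
  fun i => oapp f a (unlift ord0 i).

(* 'rV[R]_n already carries the sup norm in the library, so the Euclidean
   metric is put on an alias. *)
Definition eucl (R : realType) (n : nat) : Type := 'rV[R]_n.

HB.instance Definition _ (R : realType) n :=
  GRing.Lmodule.copy (eucl R n) 'rV[R]_n.
HB.instance Definition _ (R : realType) n := isPointed.Build (eucl R n) 0.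

Definition ecoord (R : realType) (n : nat) (x : eucl R n) (i : 'I_n) : R :=
  (x : 'rV[R]_n) ord0 i.

Definition eucl_of (R : realType) (n : nat) (f : 'I_n -> R) : eucl R n :=
  \row_i f i.

Definition eucl_dist (R : realType) (n : nat) (x y : eucl R n) : R :=
  Num.sqrt (\sum_i (ecoord x i - ecoord y i) ^+ 2).

Section euclidean_metric.
Variables (R : realType) (n : nat).
Implicit Types x y z : eucl R n.

Lemma ecoord_eucl_of (f : 'I_n -> R) i : ecoord (eucl_of f) i = f i.
Proof. by rewrite /ecoord mxE. Qed.

Lemma eucl_distxx x : eucl_dist x x = 0.
Proof.
by rewrite /eucl_dist big1 ?sqrtr0// => i _; rewrite subrr expr0n.
Qed.

Lemma eucl_dist_sym x y : eucl_dist x y = eucl_dist y x.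
Proof.
by rewrite /eucl_dist; congr Num.sqrt; apply: eq_bigr => i _; rewrite -sqrrN opprB.
Qed.

Lemma ecoord_le_dist x y i : `|ecoord x i - ecoord y i| <= eucl_dist x y.
Proof.
rewrite -sqrtr_sqr ler_wsqrtr// (bigD1 i)//= lerDl.
by apply: sumr_ge0 => j _; exact: sqr_ge0.
Qed.

Lemma eucl_dist_eq0 x y : eucl_dist x y = 0 -> x = y.
Proof.
move=> xy0; apply/rowP => i; apply/eqP; rewrite -subr_eq0 -normr_le0 -xy0.
exact: ecoord_le_dist.
Qed.

Lemma sum_cauchy_schwarz (a b : 'I_n -> R) :
  (\sum_i a i * b i) ^+ 2 <= (\sum_i a i ^+ 2) * (\sum_i b i ^+ 2).
Proof.
have : 0 <= \sum_i \sum_j (a i * b j - a j * b i) ^+ 2.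
  by apply: sumr_ge0 => i _; apply: sumr_ge0 => j _; exact: sqr_ge0.
have -> : \sum_i \sum_j (a i * b j - a j * b i) ^+ 2 =
  ((\sum_i a i ^+ 2) * (\sum_i b i ^+ 2) - (\sum_i a i * b i) ^+ 2) *+ 2.
  have E1 : \sum_i \sum_j (a i ^+ 2 * b j ^+ 2) =
            (\sum_i a i ^+ 2) * (\sum_i b i ^+ 2).
    by rewrite mulr_suml; apply: eq_bigr => i _; rewrite mulr_sumr.
  have E2 : \sum_i \sum_j (a j ^+ 2 * b i ^+ 2) =
            (\sum_i a i ^+ 2) * (\sum_i b i ^+ 2).
    by rewrite exchange_big.
  have E3 : \sum_i \sum_j (a i * b i * (a j * b j)) = (\sum_i a i * b i) ^+ 2.
    by rewrite expr2 mulr_suml; apply: eq_bigr => i _; rewrite mulr_sumr.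
  transitivity (\sum_i \sum_j (a i ^+ 2 * b j ^+ 2)
     + \sum_i \sum_j (a j ^+ 2 * b i ^+ 2)
     - (\sum_i \sum_j (a i * b i * (a j * b j))) *+ 2).
    rewrite -sumrMnl -!big_split/= -sumrB; apply: eq_bigr => i _.
    rewrite -sumrMnl -!big_split/= -sumrB; apply: eq_bigr => j _.
    ring.
  by rewrite E1 E2 E3 mulrnBl mulr2n.
by rewrite pmulrn_lge0// subr_ge0.
Qed.

Lemma eucl_dist_triangle y x z :
  eucl_dist x z <= eucl_dist x y + eucl_dist y z.
Proof.
have S0 (a : 'I_n -> R) : 0 <= \sum_i a i ^+ 2.
  by apply: sumr_ge0 => i _; exact: sqr_ge0.
have D0 (u v : eucl R n) : 0 <= eucl_dist u v by exact: sqrtr_ge0.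
rewrite -(ler_pXn2r (ltn0Sn 1)) ?nnegrE ?addr_ge0 ?D0//.
rewrite sqrrD !sqr_sqrtr; do ?exact: S0.
pose a i := ecoord x i - ecoord y i; pose b i := ecoord y i - ecoord z i.
have -> : \sum_i (ecoord x i - ecoord z i) ^+ 2 =
    \sum_i a i ^+ 2 + (\sum_i a i * b i) *+ 2 + \sum_i b i ^+ 2.
  rewrite -sumrMnl -!big_split/=; apply: eq_bigr => i _.
  by rewrite -sqrrD /a /b addrA subrK.
rewrite lerD2r lerD2l lerMn2r/=.
rewrite /eucl_dist -sqrtrM; last exact: (S0 a).
by rewrite (le_trans (ler_norm _))// -sqrtr_sqr ler_wsqrtr// sum_cauchy_schwarz.
Qed.

HB.instance Definition _ := isMetric.Build R (eucl R n)
  eucl_distxx eucl_dist_eq0 eucl_dist_sym eucl_dist_triangle.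

End euclidean_metric.

Section subset_metric.
Variables (R : realType) (Z : metricType R) (A : set Z).

Let sub_dist (x y : A) : R := mdist (set_val x) (set_val y).

Let sub_dist_ge0 x y : 0 <= sub_dist x y.
Proof. exact: mdist_ge0. Qed.

Let sub_dist_positivity x y : sub_dist x y = 0 -> x = y.
Proof. by move=> /mdist_positivity /val_inj. Qed.

Let sub_ballE (x : A) d : ball x d = [set y | sub_dist x y < d].
Proof.
have -> : ball x d = [set y | ball (set_val x) d (set_val y)] by [].
by rewrite ballEmdist.
Qed.

HB.instance Definition _ := @PseudoMetric_isMetric.Build R (A : Type)
  sub_dist sub_dist_ge0 sub_dist_positivity sub_ballE.

End subset_metric.

(* Z with its Borel sigma-algebra. *)
Notation borel Z := (g_sigma_algebraType (@open Z)).

Definition econs (R : realType) (n : nat) (p : R * eucl R n) : eucl R n.+1 :=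
  eucl_of (fcons p.1 (ecoord p.2)).

Definition euncons (R : realType) (n : nat) (x : eucl R n.+1) : R * eucl R n :=
  (ecoord x ord0, eucl_of (fun i => ecoord x (lift ord0 i))).

Section lebesgue_measure_eucl.
Variables (R : realType) (n : nat).

Lemma econsK : cancel (@econs R n) (@euncons R n).
Proof.
move=> [t v]; rewrite /econs /euncons ecoord_eucl_of /fcons unlift_none/=.
by congr pair; apply/rowP => i; rewrite mxE ecoord_eucl_of liftK.
Qed.

Lemma eunconsK : cancel (@euncons R n) (@econs R n).
Proof.
move=> x; apply/rowP => i; rewrite !mxE /fcons.
by case: unliftP => [j ->|->]//=; rewrite ecoord_eucl_of.
Qed.

Lemma eucl_dist_le_sum m (x y : eucl R m) :
  eucl_dist x y <= \sum_i `|ecoord x i - ecoord y i|.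
Proof.
have S0 : 0 <= \sum_i `|ecoord x i - ecoord y i| by apply: sumr_ge0.
rewrite -(ger0_norm S0) -sqrtr_sqr ler_wsqrtr// expr2 mulr_suml.
apply: ler_sum => i _; rewrite -real_normK ?num_real// expr2 ler_wpM2l//.
by rewrite (bigD1 i)//= lerDl sumr_ge0.
Qed.

Lemma eucl_dist_econs (s t : R) (v w : eucl R n) :
  eucl_dist (econs (s, v)) (econs (t, w)) <= `|s - t| + eucl_dist v w.
Proof.
rewrite -[leRHS]ger0_norm ?addr_ge0 ?sqrtr_ge0//.
rewrite -sqrtr_sqr ler_wsqrtr// big_ord_recl/= !ecoord_eucl_of /fcons.
rewrite unlift_none/= [leRHS]sqrrD sqr_sqrtr; last first.
  by apply: sumr_ge0 => i _; exact: sqr_ge0.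
rewrite real_normK ?num_real//.
under eq_bigr do rewrite !ecoord_eucl_of /fcons liftK/=.
by rewrite lerD2r lerDl mulrn_wge0// mulr_ge0// sqrtr_ge0.
Qed.

Let rvec (q : 'rV[rat]_n) : eucl R n := eucl_of (fun i => ratr (q ord0 i)).

Lemma eucl_rat_dense (v : eucl R n) (e : R) : 0 < e ->
  exists q, eucl_dist (rvec q) v < e.
Proof.
move=> e0; have d0 : 0 < e / n.+1%:R by rewrite divr_gt0.
have Q i : {q : rat | `|ratr q - ecoord v i| < e / n.+1%:R}.
  apply: cid; have [q] := @rat_in_itvoo R (ecoord v i - e / n.+1%:R)
    (ecoord v i + e / n.+1%:R) ltac:(by rewrite ltrD2l gtrN).
  by rewrite in_itv/= => q_in; exists q; rewrite ltr_distl.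
exists (\row_i sval (Q i)); apply: (le_lt_trans (eucl_dist_le_sum _ _)).
apply: (@le_lt_trans _ _ (\sum_(i < n) e / n.+1%:R)).
  apply: ler_sum => i _; rewrite ecoord_eucl_of mxE; apply: ltW.
  exact: (svalP (Q i)).
rewrite sumr_const card_ord -[ltLHS]mulr_natr -mulrA gtr_pMr//.
by rewrite mulrC ltr_pdivrMr// mul1r ltr_nat.
Qed.

Lemma eucl_ball_open m (x : eucl R m) (r : R) : open (ball x r).
Proof.
rewrite openE => y xy; apply/nbhs_ballP; exists (r - eucl_dist x y) => /=.
  by rewrite subr_gt0.
move=> z yz; have {}yz : eucl_dist y z < r - eucl_dist x y by [].
suff : eucl_dist x z < r by [].
by rewrite (le_lt_trans (eucl_dist_triangle y _ _))// -ltrBrDl.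
Qed.

Lemma eucl_lip_open m (Z : pseudoMetricType R) (f : eucl R m -> Z) (U : set Z) :
  (forall x y e, eucl_dist x y < e -> ball (f x) e (f y)) ->
  open U -> open (f @^-1` U).
Proof.
move=> flip oU; rewrite openE => x Ux.
have /nbhs_ballP[e /= e0 eU] : nbhs (f x) U.
  by move: oU; rewrite openE => /(_ _ Ux).
by apply/nbhs_ballP; exists e => //= y xy; apply: eU; exact: flip.
Qed.

Lemma measurable_econs :
  measurable_fun [set: measurableTypeR R * borel (eucl R n)]
    (@econs R n : _ -> borel (eucl R n.+1)).
Proof.
apply: (@measurability _ _ _ (borel (eucl R n.+1)) _ _
  (@open (eucl R n.+1))) => //.
move=> _ [U oU <-]; rewrite setTI.
pose box := (fun u : rat * 'rV[rat]_n * nat =>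
  ball (ratr u.1.1 : R) u.2.+1%:R^-1 `*` ball (rvec u.1.2) u.2.+1%:R^-1).
have -> : @econs R n @^-1` U =
    \bigcup_(u in [set u | box u `<=` @econs R n @^-1` U]) box u.
  apply/seteqP; split=> [[t v]/= Utv|p [u /= uO /uO]//].
  have /nbhs_ballP[e /= e0 eU] : nbhs (econs (t, v)) U.
    by move: oU; rewrite openE => /(_ _ Utv).
  have [k _ /(_ _ (leqnn _)) ke] : \forall k \near \oo, k.+1%:R^-1 < e / 4.
    by apply: (near_infty_natSinv_lt (PosNum (_ : 0 < e / 4))); rewrite divr_gt0.
  have k0 : 0 < k.+1%:R^-1 :> R by rewrite invr_gt0.
  have [q] := @rat_in_itvoo R (t - k.+1%:R^-1) (t + k.+1%:R^-1)
    ltac:(by rewrite ltrD2l gtrN).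
  rewrite in_itv/= => qt; have {}qt : `|ratr q - t| < k.+1%:R^-1.
    by rewrite ltr_distl.
  have [w wv] := eucl_rat_dense v k0.
  exists (q, w, k); last by split; rewrite /ball//=; rewrite /ball_//=.
  move=> [s x] [/= qs wx]; apply: eU; rewrite /ball/=.
  have {}qs : `|ratr q - s| < k.+1%:R^-1 by [].
  have {}wx : eucl_dist (rvec w) x < k.+1%:R^-1 by [].
  apply: (le_lt_trans (eucl_dist_econs _ _ _ _)).
  have ts : `|t - s| <= `|ratr q - t| + `|ratr q - s|.
    by rewrite (distrC _ t) ler_distD.
  have vx := eucl_dist_triangle (rvec w) v x.
  rewrite (eucl_dist_sym v (rvec w)) in vx.
  have e4 : e = e / 4 + e / 4 + (e / 4 + e / 4).
    by rewrite -!mulrDl -!mulr2n -mulrnA -[X in _ = X / _]mulr_natr mulfK.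
  rewrite e4; apply: ltrD.
    by apply: (le_lt_trans ts); apply: ltrD; exact: lt_trans ke.
  by apply: (le_lt_trans vx); apply: ltrD; exact: lt_trans ke.
rewrite bigcup_mkcond; apply: countable_bigcupT_measurable => // u.
case: ifPn => // _; apply: measurableX; first exact: measurable_ball.
by apply: sub_sigma_algebra; exact: eucl_ball_open.
Qed.


Variable m : {sigma_finite_measure set (borel (eucl R n)) -> \bar R}.

Let leb1 : {sigma_finite_measure set (measurableTypeR R) -> \bar R} :=
  @lebesgue_measure R.

Let prod_leb : {measure set (measurableTypeR R * borel (eucl R n))%type -> \bar R}
  := (leb1 \x m)%E.

Definition leb_step : set (borel (eucl R n.+1)) -> \bar R :=
  pushforward prod_leb (@econs R n : _ -> borel (eucl R n.+1)).

Let leb_step0 : leb_step set0 = 0%E.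
Proof. by rewrite /leb_step /pushforward preimage_set0 measure0. Qed.

Let leb_step_ge0 A : (0 <= leb_step A)%E.
Proof. by rewrite /leb_step /pushforward; exact: measure_ge0. Qed.

Let leb_step_sigma_additive : semi_sigma_additive leb_step.
Proof.
have mE := @measurable_econs.
move=> F mF tF mUF; rewrite /leb_step /pushforward preimage_bigcup.
apply: measure_semi_sigma_additive.
- by move=> k; rewrite -[X in measurable X]setTI; exact: mE.
- apply/trivIsetP => /= i j _ _ ij; rewrite -preimage_setI.
  by move/trivIsetP : tF => /(_ _ _ _ _ ij) ->//; rewrite preimage_set0.
- by rewrite -preimage_bigcup -[X in measurable X]setTI; exact: mE.
Qed.

HB.instance Definition _ := isMeasure.Build _ _ _ leb_step
  leb_step0 leb_step_ge0 leb_step_sigma_additive.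

Lemma measurable_euncons :
  measurable_fun [set: borel (eucl R n.+1)]
    (@euncons R n : borel (eucl R n.+1) -> measurableTypeR R * borel (eucl R n)).
Proof.
apply/measurable_fun_pairP; split.
- apply: (measurability _ (RGenOpens.measurableE R)) => //.
  move=> _ [U [a [b ->]] <-]; rewrite setTI; apply: sub_sigma_algebra.
  apply: eucl_lip_open => [x y e xy|]; last exact: interval_open.
  exact: le_lt_trans (ecoord_le_dist _ _ _) xy.
- apply: (@measurability _ _ _ (borel (eucl R n)) _ _
    (@open (eucl R n))) => //.
  move=> _ [U oU <-]; rewrite setTI; apply: sub_sigma_algebra.
  apply: eucl_lip_open oU => x y e; apply: le_lt_trans.
  rewrite /euncons/= -[leRHS]ger0_norm ?sqrtr_ge0//.
  rewrite -sqrtr_sqr ler_wsqrtr// sqr_sqrtr; last first.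
    by apply: sumr_ge0 => i _; exact: sqr_ge0.
  rewrite big_ord_recl/=; under eq_bigr do rewrite !ecoord_eucl_of.
  by rewrite lerDr sqr_ge0.
Qed.

Let leb_step_sigma_finite : sigma_finite setT leb_step.
Proof.
have [F UF Ffin] : sigma_finite setT prod_leb.
  have /sigma_finiteP[F [TF ndF Foo]] := sigma_finiteT leb1.
  have /sigma_finiteP[G [TG ndG Goo]] := sigma_finiteT m.
  exists (fun k => F k `*` G k).
    rewrite -setXTT TF TG; apply/seteqP; split=> [[x y]/=|[x y] [k _ []]/=].
      move=> [[i _ Fx] [k _ Gy]]; exists (maxn i k) => //; split.
      - by move: x Fx; exact/subsetPset/ndF/leq_maxl.
      - by move: y Gy; exact/subsetPset/ndG/leq_maxr.
    by split; exists k.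
  move=> k; have [mF Fk] := Foo k; have [mG Gk] := Goo k.
  split; first exact: measurableX.
  by rewrite [ltLHS]product_measure1E// lte_mul_pinfty// ge0_fin_numE.
have mE := measurable_euncons.
exists (fun k => @euncons R n @^-1` F k).
  by rewrite -preimage_bigcup -UF preimage_setT.
move=> k; have [mF Foo] := Ffin k; split.
  by rewrite -[X in measurable X]setTI; exact: mE.
rewrite /leb_step /pushforward.
rewrite [X in prod_leb X](_ : _ = F k)//.
by apply/seteqP; split => p; rewrite /preimage/= econsK.
Qed.

HB.instance Definition _ := Measure_isSigmaFinite.Build _ _ _ leb_step
  leb_step_sigma_finite.

End lebesgue_measure_eucl.

(* Lebesgue measure on the Borel sets of R^n, by recursion: on R^(n+1) it is
   the image of the product of the measures on R and R^n under econs. *)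
Fixpoint leb (R : realType) (n : nat) :
    {sigma_finite_measure set (borel (eucl R n)) -> \bar R} :=
  match n with
  | 0 => \d_(0 : borel (eucl R 0))
  | k.+1 => leb_step (leb R k)
  end.

(* Complete metric spaces; library structures carrying a sigma-algebra are
   pointed, so these are the nonempty ones (on the empty space the only current
   is 0). *)
#[short(type="completeMetricType")]
HB.structure Definition CompleteMetric (K : numDomainType) :=
  {M of Metric K M & Complete M}.

Section forms.
Variables (R : realType) (Z : metricType R).

Definition klip (k : R) (f : Z -> R) : Prop :=
  forall x y, `|f x - f y| <= k * mdist x y.

Definition is_lip (f : Z -> R) : Prop := exists k, klip k f.

Definition Lip (f : Z -> R) : R := inf [set k | 0 <= k /\ klip k f].

Definition is_form (n : nat) (h : Z -> R) (pi : 'I_n -> Z -> R) : Prop :=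
  [/\ exists M, forall z, `|h z| <= M, is_lip h & forall i, is_lip (pi i)].

(* A functional is a total function, but only its values on forms (the tuples of
   D^n(Z)) are meaningful: equality of currents is form_eq. *)
Definition functional (n : nat) : Type := (Z -> R) -> ('I_n -> Z -> R) -> R.

Definition form_eq (n : nat) (S T : functional n) : Prop :=
  forall h pi, is_form h pi -> S h pi = T h pi.

Definition boundary (n : nat) (T : functional n.+1) : functional n :=
  fun h pi => T (cst 1) (fcons h pi).

Definition upd (n : nat) (pi : 'I_n -> Z -> R) (i : 'I_n) (f : Z -> R) :
    'I_n -> Z -> R :=
  fun j => if j == i then f else pi j.

Definition multilinear (n : nat) (T : functional n) : Prop :=
  (forall a h h' pi, is_form h pi -> is_form h' pi ->
     T (fun z => a * h z + h' z) pi = a * T h pi + T h' pi) /\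
  (forall a i f f' h pi, is_form h pi -> is_lip f -> is_lip f' ->
     T h (upd pi i (fun z => a * f z + f' z)) =
     a * T h (upd pi i f) + T h (upd pi i f')).

Definition continuous_functional (n : nat) (T : functional n) : Prop :=
  forall h pi (pis : nat -> 'I_n -> Z -> R), is_form h pi ->
    (exists k, forall j i, klip k (pis j i)) ->
    (forall i z, pis j i z @[j --> \oo] --> pi i z) ->
    T h (pis j) @[j --> \oo] --> T h pi.

Definition local_functional (n : nat) (T : functional n) : Prop :=
  forall h pi i, is_form h pi ->
    (exists (U : set Z) c, [/\ open U, [set z | h z != 0] `<=` U &
       forall z, U z -> pi i z = c]) ->
    T h pi = 0.

End forms.

Definition push (R : realType) (Z Z' : metricType R) (f : Z -> Z') (n : nat)
    (T : functional Z n) : functional Z' n :=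
  fun h pi => T (h \o f) (fun i => pi i \o f).

Definition isometric (R : realType) (Z Z' : metricType R) (f : Z -> Z') : Prop :=
  forall x y, mdist (f x) (f y) = mdist x y.

Definition bilipschitz (R : realType) (Z Z' : metricType R) (f : Z -> Z') : Prop :=
  exists a b : R, [/\ 0 < a, 0 < b & forall x y,
    a * mdist x y <= mdist (f x) (f y) <= b * mdist x y].

(* T is S regarded as a functional on Z. Every form on A extends to a form on Z
   (McShane, truncating h), so T determines S on forms: "S is T viewed as a
   current on A". *)
Definition viewed_on (R : realType) (Z : metricType R) (n : nat) (A : set Z)
    (T : functional Z n) (S : functional A n) : Prop :=
  form_eq (push set_val S) T.

Section mass.
Variables (R : realType) (Z : completeMetricType R) (n : nat).
Implicit Types (T : functional Z n).
Local Notation measureZ := {measure set (borel Z) -> \bar R}.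

Definition controls (T : functional Z n) (mu : measureZ) : Prop :=
  (mu setT < +oo)%E /\
  forall h pi, is_form h pi ->
    (`|T h pi|%:E <=
       (\prod_i Lip (pi i))%:E * \int[mu]_z `|h z|%:E)%E.

Definition is_current T : Prop :=
  [/\ multilinear T, continuous_functional T, local_functional T &
      exists mu, controls T mu].

Definition is_mass_measure T (mu : measureZ) : Prop :=
  controls T mu /\
  forall nu : measureZ, controls T nu ->
    forall A, measurable A -> (mu A <= nu A)%E.

(* The measure that is +oo on nonempty sets: the value of mass_measure when there
   is no minimal controlling measure, so that functionals of infinite mass get
   mass +oo. For a current the minimal measure exists. *)
Definition infinite_measure : measureZ :=
  mseries (fun=> counting : measureZ) 0.

Definition mass_measure T : measureZ :=
  if pselect (exists mu, is_mass_measure T mu) is left e then sval (cid e)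
  else infinite_measure.

Definition mass T : \bar R := mass_measure T setT.

(* The constant omega_m. *)
Definition unit_ball_volume (m : nat) : R :=
  fine (leb R m [set x | eucl_dist x 0 <= 1]).

Definition charset T : set Z :=
  [set z | (0 < limf_einf (fun r : R =>
      mass_measure T [set y | (mdist z y <= r)%R] *
      ((unit_ball_volume n * r ^+ n)^-1)%:E) 0^'+)%E].

End mass.

(* By Rademacher's theorem the partial derivatives of a Lipschitz function exist
   almost everywhere; derive1 is 0 where the limit does not exist. *)
Definition partial (R : realType) (n : nat) (i : 'I_n) (f : eucl R n -> R)
    (x : eucl R n) : R :=
  derive1 (fun t : R => f (x + t *: (delta_mx ord0 i : eucl R n))) 0.

Definition eucl_current (R : realType) (n : nat) (theta : eucl R n -> R) :
    functional (eucl R n) n :=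
  fun h pi => \int[leb R n]_x
    (theta x * h x * \det (\matrix_(i, j) partial i (pi j) x)).

Definition ess_supp (R : realType) (n : nat) (theta : eucl R n -> R) :
    set (eucl R n) :=
  [set x | forall U : set (eucl R n), open U -> U x ->
     ~ {ae leb R n, forall y, U y -> theta y = 0}].

Definition integer_rectifiable (R : realType) (Z : completeMetricType R)
    (n : nat) (T : functional Z n) : Prop :=
  exists (K : nat -> set (eucl R n)) (theta : nat -> eucl R n -> int)
    (phi : forall k, K k -> Z) (S : forall k, functional (K k) n),
    let thetaR k x : R := (theta k x)%:~R in
    [/\ forall k, compact (K k) /\
          (leb R n).-integrable setT (EFin \o thetaR k),
        forall k, ess_supp (thetaR k) `<=` K k,
        forall k, bilipschitz (phi k) /\ viewed_on (eucl_current (thetaR k)) (S k),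
        forall h pi, is_form h pi ->
          \sum_(0 <= k < N) push (phi k) (S k) h pi @[N --> \oo] --> T h pi &
        mass T = (\sum_(0 <= k <oo) mass (push (phi k) (S k)))%E].

Definition integral_current (R : realType) (Z : completeMetricType R) (n : nat)
    (T : functional Z n) : Prop :=
  [/\ is_current T, integer_rectifiable T &
      match n return functional Z n -> Prop with
      | 0 => fun=> True
      | _.+1 => fun T' => is_current (boundary T')
      end T].

(* The pair (X, T), together with a completion of X: a complete space into which
   X embeds isometrically with dense image. The boundary space of (X, T) has
   the current boundary T. *)
Record integral_current_space (R : realType) (n : nat) := IntegralCurrentSpace {
  ics_space :> metricType R ;
  ics_completion : completeMetricType R ;
  ics_emb : ics_space -> ics_completion ;
  ics_emb_isometric : isometric ics_emb ;
  ics_emb_dense : dense (range ics_emb) ;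
  ics_current : functional ics_completion n ;
  ics_integral : integral_current ics_current ;
  ics_charset : charset ics_current = range ics_emb
}.

Arguments ics_emb {R n} X _ : rename.
Arguments ics_current {R n} X _ _ : rename.

Definition convex_body (R : realType) (n : nat) (C : set (eucl R n)) : Prop :=
  [/\ convex_set (C : set (convex_lmodType 'rV[R]_n)), compact C & C° !=set0].

Definition frontier (T : topologicalType) (A : set T) : set T :=
  closure A `\` A°.

(* Main.v *)
Require Import Defs.
From mathcomp Require Import all_boot all_order all_algebra.
From mathcomp Require Import all_classical all_reals all_analysis.
From mathcomp Require Import finmap lra.

Set Implicit Arguments.
Unset Strict Implicit.
Unset Printing Implicit Defensive.

Import Order.TTheory GRing.Theory Num.Theory.
Import numFieldNormedType.Exports.

Local Open Scope classical_set_scope.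
Local Open Scope ring_scope.

(* The coordinate functions of C restricted to its frontier are 1-Lipschitz, so
   by McShane they extend to 1-Lipschitz functions pi_0, ..., pi_n on the
   completion of X. (No metric constant is lost: the mass only sees the pi_i one
   at a time, so the map they form need not be 1-Lipschitz.) The value of the current of X on (1, pi_0, ..., pi_n) depends
   only on its boundary, hence equals the value of [[C]] on (1, x_0, ..., x_n),
   which is the volume of C; on the other hand it is at most the mass. The
   function playing the role of the coefficient in the boundary has to be
   bounded, so x_0 is clamped to an interval containing its values on C. *)

(** * Lipschitz functions: extension and truncation *)

Section lipschitz.
Variables (R : realType) (Z : metricType R).
Implicit Types f : Z -> R.

Lemma klip_continuous f : klip 1 f -> continuous f.
Proof.
move=> f1 x; apply/cvgrPdist_lt => e e0; near=> y.
rewrite (le_lt_trans (f1 x y))// mul1r.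
suff : ball x e y by rewrite ballEmdist.
by near: y; exact: nbhsx_ballx.
Unshelve. all: by end_near. Qed.

Lemma Lip_ge0 f : 0 <= Lip f.
Proof.
rewrite /Lip; have [->|/set0P ne] := eqVneq [set k | 0 <= k /\ klip k f] set0.
  by rewrite inf0.
by apply: lb_le_inf => // k [].
Qed.

Lemma Lip_le f k : 0 <= k -> klip k f -> Lip f <= k.
Proof. by move=> k0 fk; apply: ge_inf; [exists 0 => ? []|split]. Qed.

Lemma klip_mdist (z : Z) : klip 1 (mdist z).
Proof.
move=> x y; rewrite mul1r ler_distl lerBlDr metric_triangle/=.
by rewrite (metric_sym x) metric_triangle.
Qed.

(** Infimal convolution: [F z] is the infimum over [a] of [f a + mdist z (j a)], and each of these
    functions is 1-Lipschitz in [z]. At a point [j a] the index [a] itself is optimal, because [f]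
    is 1-Lipschitz. *)
Lemma McShane_extension (A : metricType R) (j : A -> Z) (f : A -> R) :
  isometric j -> klip 1 f -> exists F : Z -> R, klip 1 F /\ F \o j = f.
Proof.
move=> isoj f1; have [[a0 _]|A0] := pselect (exists a : A, True); last first.
  exists (cst 0); split=> [x y|]; first by rewrite subrr normr0 mul1r mdist_ge0.
  by apply/funext => a; exfalso; apply: A0; exists a.
pose E z := [set f a + mdist z (j a) | a in [set: A]].
have E0 z : E z !=set0 by exists (f a0 + mdist z (j a0)); exists a0.
have fle a b : f a <= f b + mdist (j a) (j b).
  by rewrite isoj -lerBlDl (le_trans (ler_norm _))// -[leRHS]mul1r.
have lbE z : has_lbound (E z).
  exists (f a0 - mdist z (j a0)) => _ [a _ <-].
  rewrite lerBlDr (le_trans (fle a0 a))// -addrA lerD2l addrC.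
  by rewrite (metric_sym z (j a0)) metric_triangle.
pose F z := inf (E z).
have FD x y : F x <= F y + mdist x y.
  rewrite -lerBlDr; apply: lb_le_inf => // _ [a _ <-].
  rewrite lerBlDr (@le_trans _ _ (f a + mdist x (j a)))//.
    by apply: ge_inf => //; exists a.
  by rewrite -addrA lerD2l addrC metric_triangle.
exists F; split=> [x y|].
  rewrite mul1r ler_distl FD andbT lerBlDr.
  by rewrite metric_sym FD.
apply/funext => a /=; apply/eqP; rewrite eq_le; apply/andP; split.
  by rewrite -[leRHS]addr0 -(mdistxx (j a)); apply: ge_inf => //; exists a.
by apply: lb_le_inf => // _ [b _ <-]; exact: fle.
Qed.

Definition clamp (M x : R) : R := Num.max (- M) (Num.min M x).

Lemma clamp_id M x : `|x| <= M -> clamp M x = x.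
Proof.
by rewrite ler_norml => /andP[Mx xM]; rewrite /clamp min_r// max_r.
Qed.

Lemma clamp_bounded M x : 0 <= M -> `|clamp M x| <= M.
Proof.
move=> M0; rewrite ler_norml /clamp le_max lexx/= ge_max ge_min lexx/=.
by rewrite andbT (le_trans _ M0)// oppr_le0.
Qed.

Lemma clamp_le_dist M x y : `|clamp M x - clamp M y| <= `|x - y|.
Proof.
rewrite /clamp; case: (leP M x) => ?; case: (leP M y) => ?;
  do ?[case: (leP (- M)) => ?]; case: (ler0P (x - y)) => ?;
  by rewrite ?ler_norml; first [lra|apply/andP; split; lra].
Qed.

Lemma klip_clamp M f : klip 1 f -> klip 1 (clamp M \o f).
Proof. by move=> f1 x y; rewrite (le_trans (clamp_le_dist _ _ _)). Qed.

End lipschitz.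

(** Test the control inequality on [h = 1]: each factor [Lip (pi i)] is at most 1, which leaves the
    total mass of the measure. If there is no minimal measure, [mass T] is [+oo] by convention. *)
Lemma le_mass (R : realType) (Z : completeMetricType R) (n : nat)
    (T : functional Z n) (pi : 'I_n -> Z -> R) :
  (forall i, klip 1 (pi i)) -> (`|T (cst 1) pi|%:E <= mass T)%E.
Proof.
move=> pi1; rewrite /mass /mass_measure; case: pselect => [e|_].
  case: (cid e) => /= mu [[_ Tmu] _].
  have F : is_form (cst 1) pi.
    split; first by exists 1 => z; rewrite normr1.
      by exists 0 => x y; rewrite subrr normr0 mul0r.
    by move=> i; exists 1.
  apply: (le_trans (Tmu _ _ F)).
  under eq_integral do rewrite /cst normr1.
  rewrite integral_cst// mul1e -[leRHS]mul1e lee_wpmul2r// lee_fin.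
  by apply: prodr_ile1 => i _; rewrite Lip_ge0/=; exact: Lip_le.
(* [infinite_measure] sums countably many counting measures, each at least 1 on the pointed space,
   so finitely many terms already exceed any real [A]. *)
suff -> : @infinite_measure R Z setT = +oo%E by exact: leey.
rewrite [LHS]/=; apply/eqyP => A A0.
pose N := (Num.truncn A).+1.
have c1 : (1 <= @counting Z R setT)%E.
  rewrite /counting; case: asboolP => [fin|_]; last exact: leey.
  rewrite lee_fin ler1n cardfs_gt0; apply/fset0Pn; exists point.
  by rewrite in_fset_set// mem_set.
apply: (@le_trans _ _ (\sum_(0 <= k < N) @counting Z R setT)%E); last first.
  by apply: nneseries_lim_ge => k _ _; exact: le_trans c1.
apply: (@le_trans _ _ (\sum_(0 <= k < N) 1)%E); last exact: lee_sum.
rewrite sumEFin sumr_const_nat subn0 lee_fin ltW//.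
exact: truncnS_gt.
Qed.

(** * Coordinates, boxes and the current of a set in Euclidean space *)

Section euclidean.
Variables (R : realType).

Lemma klip_ecoord (n : nat) (i : 'I_n) : klip 1 (fun x : eucl R n => ecoord x i).
Proof. by move=> x y; rewrite mul1r; exact: ecoord_le_dist. Qed.

Lemma ecoord_shift (n : nat) (x : eucl R n) (t : R) (i j : 'I_n) :
  ecoord (x + t *: (delta_mx ord0 i : eucl R n)) j = ecoord x j + t * (i == j)%:R.
Proof. by rewrite /ecoord !mxE eqxx/= eq_sym. Qed.

(** A shift by [t] along axis [i] moves coordinate [j] by at most [|t|], hence stays in the slab
    where [f] is known; the difference quotient is constant for small nonzero [t]. *)
Lemma partial_near_ecoord (n : nat) (i j : 'I_n) (f : eucl R n -> R)
    (x : eucl R n) (e : R) :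
  0 < e -> (forall y, `|ecoord y j - ecoord x j| < e -> f y = ecoord y j) ->
  partial i f x = (i == j)%:R.
Proof.
move=> e0 fE; rewrite /partial /derive1; apply: cvg_lim => //.
have fxE t : `|t| < e -> f (x + t *: (delta_mx ord0 i : eucl R n)) =
    ecoord x j + t * (i == j)%:R.
  move=> te; rewrite fE ecoord_shift// addrAC subrr add0r.
  by case: (i == j); rewrite ?mulr1// mulr0 normr0.
apply: cvg_near_cst; near=> t.
have t0 : t != 0 by near: t; exact: nbhs_dnbhs_neq.
rewrite addr0 !fxE ?normr0//; last first.
  by near: t; apply: dnbhs0_lt.
by rewrite mul0r addr0 addrAC subrr add0r /= /GRing.scale/= mulKf.
Unshelve. all: by end_near. Qed.

Lemma measurable_closed (n : nat) (A : set (eucl R n)) :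
  closed A -> measurable (A : set (borel (eucl R n))).
Proof.
move=> cA; rewrite -[A]setCK; apply: measurableC.
by apply: sub_sigma_algebra; exact: closed_openC.
Qed.

(** Sup-norm balls, because [econs] splits them as an interval times a smaller box, matching the
    recursion that defines [leb]. *)
Definition eucl_box (n : nat) (M : R) : set (eucl R n) :=
  [set x | forall i, `|ecoord x i| <= M].
Arguments eucl_box : clear implicits.

Lemma closed_box n M : closed (eucl_box n M).
Proof.
have -> : eucl_box n M =
    \bigcap_(i in setT) ((fun x => ecoord x i) @^-1` `[- M, M]).
  by apply/seteqP; split=> x /= xM i => [_|];
    have := xM i; rewrite /= in_itv/= ler_norml//; exact.
apply: closed_bigI => i _.
have /continuous_closedP : continuous (fun x : eucl R n => ecoord x i).
  exact/klip_continuous/klip_ecoord.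
by apply; exact: interval_closed.
Qed.

Lemma leb_box_fin n M : (leb R n (eucl_box n M) < +oo)%E.
Proof.
elim: n => [|n IH].
  by rewrite [ltLHS]/= /dirac indicE ltry.
rewrite -[ltLHS]/((@lebesgue_measure R \x leb R n)%E
  (@econs R n @^-1` eucl_box n.+1 M)).
have -> : @econs R n @^-1` eucl_box n.+1 M = `[- M, M]%classic `*` eucl_box n M.
  apply/seteqP; split=> [[t v]|[t v]]/=.
    move=> tvM; split.
      rewrite in_itv/= -ler_norml; have := tvM ord0.
      by rewrite /econs ecoord_eucl_of /fcons unlift_none.
    move=> i; have := tvM (lift ord0 i).
    by rewrite /econs ecoord_eucl_of /fcons liftK.
  rewrite in_itv/= -ler_norml => -[tM vM] i.
  by rewrite /econs ecoord_eucl_of /fcons; case: unliftP => [k|] _ /=.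
rewrite [ltLHS]product_measure1E//; last first.
  exact: (measurable_closed (@closed_box n M)).
rewrite lte_mul_pinfty// ge0_fin_numE//.
by rewrite [ltLHS](lebesgue_measure_itv `[- M, M])/=; case: ifPn; rewrite ?ltry.
Qed.

Lemma compact_sub_box n (C : set (eucl R n)) :
  compact C -> exists M, C `<=` eucl_box n M.
Proof.
move=> cC.
have : compact (eucl_dist 0 @` C).
  apply: continuous_compact => //; apply: continuous_subspaceT.
  exact/klip_continuous/klip_mdist.
(* Every constant above [M] is a bound; [M + 1] is one of them. *)
move=> /compact_bounded[M [_ /(_ (M + 1))]]; rewrite ltrDl ltr01 => /(_ isT) CM.
exists (M + 1) => x Cx i; apply: le_trans (CM (eucl_dist 0 x) _); last by exists x.
rewrite (le_trans _ (ler_norm _))//; have := ecoord_le_dist 0 x i.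
by rewrite /ecoord mxE sub0r normrN.
Qed.

(** At points of [C] the Jacobian matrix is the identity, and elsewhere the indicator kills the
    integrand. Agreement with the coordinates is asked beyond [C] itself, since partial derivatives
    at its frontier points look outside. *)
Lemma eucl_current_coordinates n (C : set (eucl R n)) (e : R)
    (pi : 'I_n -> eucl R n -> R) :
  measurable (C : set (borel (eucl R n))) -> 0 < e ->
  (forall x y j, C x -> `|ecoord y j - ecoord x j| < e ->
     pi j y = ecoord y j) ->
  eucl_current \1_C (cst 1) pi = fine (leb R n C).
Proof.
move=> mC e0 piE; rewrite /eucl_current /Rintegral; congr fine.
transitivity (\int[leb R n]_x (\1_C x : R)%:E)%E; last first.
  by rewrite integral_indic// setIT.
apply: eq_integral => x _.
rewrite /cst mulr1 indicE; have [/set_mem Cx|_] := boolP (x \in C); last first.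
  by rewrite mul0r.
rewrite mul1r [X in \det X](_ : _ = 1%:M) ?det1//.
apply/matrixP => i j; rewrite !mxE; apply: (partial_near_ecoord _ e0) => y.
exact: piE.
Qed.

End euclidean.

(* The dimension is n.+1; dC is the current of C's boundary on the metric space
   frontier C. *)
Theorem lemma6p1 (R : realType) (n : nat) (C : set (eucl R n.+1))
    (X : integral_current_space R n.+1)
    (iota : frontier C -> X) (dC : functional (frontier C) n) :
  convex_body C ->
  isometric iota ->
  viewed_on (boundary (eucl_current \1_C)) dC ->
  form_eq (push (ics_emb X \o iota) dC) (boundary (ics_current X)) ->
  (leb R n.+1 C <= mass (ics_current X))%E.
Proof.
move=> [_ cC _] iso_iota dCE TE.
have clC : closed C by apply: compact_closed => //; exact: metric_hausdorff.
have mC := measurable_closed clC.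
have [M0 CM0] := compact_sub_box cC.
(* The absolute value makes [M] nonnegative; the extra 1 is a margin within which clamping leaves
   the first coordinate unchanged near [C], so its derivatives there are unaffected. *)
pose M := `|M0| + 1; have M_ge0 : 0 <= M by rewrite addr_ge0.
have lebC : leb R n.+1 C \is a fin_num.
  rewrite ge0_fin_numE//; apply: le_lt_trans (leb_box_fin n.+1 M0).
  apply: le_measure; [exact: mem_set|apply: mem_set|exact: CM0].
  exact: (measurable_closed (@closed_box R n.+1 M0)).
pose j := ics_emb X \o iota.
have iso_j : isometric j by move=> x y; rewrite /j/= ics_emb_isometric iso_iota.
have /choice[pi piP] (i : 'I_n.+1) : exists F : ics_completion X -> R,
    klip 1 F /\ F \o j = (fun x => ecoord (set_val x) i).
  by apply: McShane_extension => // x y; exact: klip_ecoord.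
(* [h], [rho] live on the completion of [X] and [h'], [rho'] on Euclidean space; their pullbacks to
   the frontier of [C] coincide. *)
pose h := clamp M \o pi ord0.
pose rho (i : 'I_n) := pi (lift ord0 i).
pose h' (x : eucl R n.+1) := clamp M (ecoord x ord0).
pose rho' (i : 'I_n) (x : eucl R n.+1) := ecoord x (lift ord0 i).
have h1 : klip 1 h by apply: klip_clamp; case: (piP ord0).
have form_h : is_form h rho.
  split; [by exists M => z; exact: clamp_bounded|by exists 1|].
  by move=> i; exists 1; case: (piP (lift ord0 i)).
have form_h' : is_form h' rho'.
  split; first by exists M => z; exact: clamp_bounded.
    by exists 1; exact/klip_clamp/klip_ecoord.
  by move=> i; exists 1; exact: klip_ecoord.
have : ics_current X (cst 1) (fcons h rho) = fine (leb R n.+1 C).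
  (* The value is that of the boundary current, which [TE] pulls back to [dC]; after the forms are
     matched on the frontier, [dCE] passes to the boundary of the current of [C]. *)
  rewrite -[LHS]/(boundary _ h rho) -TE// /push.
  have -> : h \o j = h' \o set_val.
    apply/funext => x; rewrite /h /h' /=; congr clamp.
    by have [_ /(congr1 (fun g => g x))] := piP ord0.
  have -> : (fun i => rho i \o j) = (fun i => rho' i \o set_val).
    by apply/funext => i; have [_] := piP (lift ord0 i).
  rewrite -[LHS]/(push set_val dC h' rho') dCE// /boundary.
  apply: (@eucl_current_coordinates _ _ _ 1) => // x y i Cx xy.
  rewrite /fcons; case: unliftP => [k ->//|i0] /=.
  rewrite i0 /h' clamp_id//; have := CM0 _ Cx ord0; rewrite /M.
  move: xy; rewrite i0 => xy x0.
  have := ler_norm M0; have := lerB_dist (ecoord y ord0) (ecoord x ord0).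
  lra.
move=> T_C; rewrite -(fineK lebC) -T_C.
apply: (@le_trans _ _ `|ics_current X (cst 1) (fcons h rho)|%:E).
  by rewrite lee_fin ler_norm.
apply: le_mass => i; rewrite /fcons; case: unliftP => [k|] _ //=.
by case: (piP (lift ord0 k)).
Qed.
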